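(* For any integers $1\leq m\leq b$ and any integers $t>s\geq 2m+1$, there exists a graph $G$ such that $s_{MB}(G,m:b)=s$, but in the $(m:b)$ Maker-Breaker domination game on $G$ (Dominator starting) Staller can play so that Dominator cannot occupy a dominating set of size $s$ before she has occupied another minimal dominating set of size $t$.
   Context: The $(m:b)$ Maker-Breaker domination game on a graph $G$ is played by Dominator and Staller on $V(G)$: they alternate moves, Dominator claiming up to $m$ unclaimed vertices per move and Staller up to $b$ unclaimed vertices per move; Dominator wins if she claims all vertices of some dominating set of $G$. $s_{MB}(G,m:b)$ is the smallest size of a dominating set that Dominator can always claim when she is the first player ($\infty$ if she has no winning strategy). A minimal dominating set is a dominating set none of whose proper subsets is dominating. *)

(* Defs.v *)
From mathcomp Require Import all_boot.

Set Implicit Arguments.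
Unset Strict Implicit.
Unset Printing Implicit Defensive.

Record sgraph := SGraph {
  vertex :> finType;
  adj : rel vertex;
  adj_sym : symmetric adj;
  adj_irrefl : irreflexive adj
}.

Section Game.
Variable G : sgraph.
Implicit Types (X Y D : {set G}).

Definition dominating X : bool :=
  [forall v, (v \in X) || [exists u in X, adj u v]].

(* A round is a move of Dominator (first component) followed by the reply of
   Staller (second component); a history is the list of completed rounds,
   oldest first. *)
Definition history := seq ({set G} * {set G}).
Implicit Type h : history.

Definition dclaimed h : {set G} := \bigcup_(r <- h) r.1.
Definition sclaimed h : {set G} := \bigcup_(r <- h) r.2.
Definition unclaimed h : {set G} := ~: (dclaimed h :|: sclaimed h).

(* Strategies may depend on the whole history; Staller also sees the current
   move of Dominator. *)
Definition dstrategy := history -> {set G}.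
Definition sstrategy := history -> {set G} -> {set G}.

(* "Up to m" includes the empty move.  It is the only legal one once all
   vertices are claimed, so plays can be taken infinite. *)
Definition dlegal (m : nat) (sd : dstrategy) : Prop :=
  forall h, (sd h \subset unclaimed h) && (#|sd h| <= m).

Definition slegal (b : nat) (ss : sstrategy) : Prop :=
  forall h X, (ss h X \subset unclaimed h :\: X) && (#|ss h X| <= b).

Fixpoint play (sd : dstrategy) (ss : sstrategy) (n : nat) : history :=
  if n is n'.+1 then
    let h := play sd ss n' in rcons h (sd h, ss h (sd h))
  else [::].

(* The play does not stop when Dominator first owns a dominating set: only the
   size of a dominating set inside her claimed set matters, not the number of
   vertices she has claimed. *)
Definition can_claim (m b k : nat) : Prop :=
  exists2 sd, dlegal m sd &
    forall ss, slegal b ss ->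
      exists n Y, [/\ Y \subset dclaimed (play sd ss n), dominating Y & #|Y| <= k].

(* s_MB(G, m:b) = s for a finite s; the value is infinite exactly when no s
   satisfies this. *)
Definition s_MB_is (m b s : nat) : Prop :=
  can_claim m b s /\ forall k, can_claim m b k -> s <= k.

Definition occupies_dominating (k : nat) D : Prop :=
  exists Y, [/\ Y \subset D, dominating Y & #|Y| = k].

Definition occupies_min_dominating (k : nat) D : Prop :=
  exists Y, [/\ Y \subset D, minset dominating Y & #|Y| = k].

(* "Before" is strict: the minimal dominating set of size t is already complete
   after an earlier move of Dominator. *)
Definition staller_can_force (m b s t : nat) : Prop :=
  exists2 ss, slegal b ss &
    forall sd, dlegal m sd ->
      forall n, occupies_dominating s (dclaimed (play sd ss n)) ->
        exists2 n', n' < n &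
          occupies_min_dominating t (dclaimed (play sd ss n')).

End Game.

(* Main.v *)
Require Import Defs.
From mathcomp Require Import all_boot.
From mathcomp Require Import zify.

Set Implicit Arguments.
Unset Strict Implicit.
Unset Printing Implicit Defensive.

(** Let a family of winning sets of cells consist of all sets of at least [t]
    cells, and of all sets of at least [s] cells that contain a "core".  Such a
    monotone family is the family of dominating sets of a graph, up to sets of
    size at least [t], so everything is about how long the first core takes.

    A core has at most [2m + 1] cells and lives on a flower: [b + 1] cycles
    (petals) of length [n = 2^t] through a common hub, where each node is a
    block of [m] cells, each link carries [b] cells, and a core consists of two
    adjacent blocks and one cell of the link between them.

    Dominator claims the hub and then walks along a petal that Staller has not
    touched.  Each step threatens the [b] cells of one link, so Staller has no
    free move, and the last step threatens [2b] cells.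

    Staller delays as follows.  When Dominator completes a block in one move,
    he cuts one of its two links, on the side where the nearest owned block is
    closer; otherwise he spoils, with one cell each, the blocks and links that
    she touched.  Consecutive owned blocks that are not separated by a cut stay
    at distance at least [2^(t - d)], where [d] is the number of cells owned by
    Dominator.  So she owns [t] cells before her first core, and any [t] cells
    without a core form a minimal dominating set. *)

Lemma subset_between (T : finType) (A D : {set T}) k :
  A \subset D -> #|A| <= k <= #|D| ->
  exists Y : {set T}, [/\ A \subset Y, Y \subset D & #|Y| = k].
Proof.
move=> sAD /andP[leAk lekD].
pose r := take (k - #|A|) (enum (D :\: A)).
have rP x : x \in r -> (x \in D) && (x \notin A).
  by move/mem_take; rewrite mem_enum inE andbC.
exists (A :|: [set x in r]); split; first exact: subsetUl.
  by rewrite subUset sAD; apply/subsetP => x; rewrite inE => /rP/andP[].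
have /eqP dis : A :&: [set x in r] == set0.
  rewrite setI_eq0 disjoint_sym; apply/pred0P => x /=; rewrite inE.
  by apply/negP => /andP[/rP/andP[_ /negP]].
rewrite cardsU dis cards0 subn0 cardsE.
have /card_uniqP -> : uniq r by rewrite take_uniq ?enum_uniq.
rewrite size_take -cardE cardsD (setIidPr sAD).
by case: ltnP; lia.
Qed.

(** * The game on cells, with a fixed number of rounds *)

Section PositionalGame.
Variables (T : finType) (m b : nat) (goal : pred {set T}).
Implicit Types D B X Z F : {set T}.

Definition legal q F X := (X \subset F) && (#|X| <= q).

(** Testing the goal only after the last round suits goals that survive further claims. Being
    boolean, this lets a strategy be extracted by [pick]. *)
Fixpoint wins_in k D B :=
  if k is k'.+1 then
    [exists X : {set T}, legal m (~: (D :|: B)) X &&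
      [forall Z : {set T}, legal b (~: (D :|: B) :\: X) Z ==>
         wins_in k' (D :|: X) (B :|: Z)]]
  else goal D.

Lemma wins_inS k D B X :
  legal m (~: (D :|: B)) X ->
  (forall Z, legal b (~: (D :|: B) :\: X) Z ->
     wins_in k (D :|: X) (B :|: Z)) ->
  wins_in k.+1 D B.
Proof.
move=> lX H; apply/existsP; exists X; rewrite lX; apply/forallP => Z.
by apply/implyP/H.
Qed.

Lemma card_round D B X Z F F' :
  legal m F X -> legal b F' Z ->
  #|(D :|: X) :|: (B :|: Z)| <= #|D :|: B| + (m + b).
Proof.
move=> /andP[_ cX] /andP[_ cZ].
rewrite setUACA (leq_trans (leq_card_setU _ _)) // leq_add2l.
by rewrite (leq_trans (leq_card_setU _ _)) // leq_add.
Qed.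

End PositionalGame.

(** * From the game on cells to the game on the graph *)

Section Transfer.
Variables (G : sgraph) (T : finType) (f : T -> G) (m b : nat).
Hypothesis f_inj : injective f.

Lemma preimsetU_claimed (h : history G) :
  f @^-1: unclaimed h = ~: (f @^-1: dclaimed h :|: f @^-1: sclaimed h).
Proof. by rewrite /unclaimed preimsetC preimsetU. Qed.

Lemma imset_legal q (U : {set G}) (X : {set T}) :
  legal q (f @^-1: U) X -> (f @: X \subset U) && (#|f @: X| <= q).
Proof.
by case/andP=> sX cX; rewrite sub_imset_pre sX card_imset.
Qed.

Lemma preimset_legal q (U X : {set G}) :
  (X \subset U) && (#|X| <= q) -> legal q (f @^-1: U) (f @^-1: X).
Proof.
case/andP=> sX cX; rewrite /legal preimsetS // (leq_trans _ cX) //.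
rewrite -(card_imset _ f_inj) subset_leq_card //.
by rewrite sub_imset_pre.
Qed.

Lemma preimset_imset (X : {set T}) : f @^-1: (f @: X) = X.
Proof. by apply/setP => x; rewrite inE mem_imset. Qed.

Lemma size_play (sd : dstrategy G) (ss : sstrategy G) n :
  size (play sd ss n) = n.
Proof. by elim: n => //= n IHn; rewrite size_rcons IHn. Qed.

Lemma dclaimed_rcons (h : history G) r :
  dclaimed (rcons h r) = dclaimed h :|: r.1.
Proof. by rewrite /dclaimed big_rcons /= setUC. Qed.

Lemma sclaimed_rcons (h : history G) r :
  sclaimed (rcons h r) = sclaimed h :|: r.2.
Proof. by rewrite /sclaimed big_rcons /= setUC. Qed.

(** Dominator plays inside the image of [f] and sees only the trace of Staller's moves there. The
    length of the history tells how many rounds remain. *)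
Lemma wins_in_can_claim (goal : pred {set T}) k N :
  (forall D, goal D ->
     exists Y : {set G}, [/\ Y \subset f @: D, dominating Y & #|Y| <= k]) ->
  wins_in m b goal N set0 set0 -> can_claim G m b k.
Proof.
move=> goalP win0.
pose dd (h : history G) := f @^-1: dclaimed h.
pose bb (h : history G) := f @^-1: sclaimed h.
pose ok h X := legal m (~: (dd h :|: bb h)) X &&
  [forall Z : {set T}, legal b (~: (dd h :|: bb h) :\: X) Z ==>
     wins_in m b goal (N - (size h).+1) (dd h :|: X) (bb h :|: Z)].
(* The default is the empty move, so the strategy is legal on every history, reachable or not. *)
pose sd h : {set G} := f @: odflt set0 [pick X | ok h X].
exists sd.
  move=> h; apply: imset_legal; rewrite preimsetU_claimed.
  by case: pickP => [X /andP[]//|_]; rewrite /legal sub0set cards0.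
move=> ss lss.
have inv n : n <= N ->
    wins_in m b goal (N - n) (dd (play sd ss n)) (bb (play sd ss n)).
  elim: n => [_|n IHn ltnN].
    by rewrite subn0 /dd /bb /dclaimed /sclaimed /= !big_nil preimset0.
  move: (IHn (ltnW ltnN)); rewrite -(subnSK ltnN) /=.
  set h := play sd ss n => /existsP[X0 okX0].
  rewrite /dd /bb dclaimed_rcons sclaimed_rcons /= !preimsetU.
  rewrite [in X in wins_in _ _ _ _ X _]/sd preimset_imset.
  have sz : size h = n by apply: size_play.
  have [X okX def_sd] : exists2 X, ok h X & sd h = f @: X.
    rewrite /sd; case: pickP => [X okX|/(_ X0)]; first by exists X.
    by rewrite /ok sz okX0.
  have -> : odflt set0 [pick X | ok h X] = X.
    by rewrite -[LHS]preimset_imset -/(sd h) def_sd preimset_imset.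
  case/andP: okX => _ /forallP/(_ (f @^-1: ss h (sd h)))/implyP.
  rewrite sz; apply.
  rewrite -preimsetU_claimed -[X in _ :\: X]preimset_imset -def_sd -preimsetD.
  exact/preimset_legal/lss.
have := inv N (leqnn N); rewrite subnn /= => /goalP[Y [sY dY cY]].
exists N, Y; split=> //; apply: (subset_trans sY).
by rewrite sub_imset_pre.
Qed.

(** Claimed sets only grow, so if Dominator has fewer than [t] cells now, she had fewer at every
    earlier round, and [step] applied each time. *)
Lemma staller_invariant (inv : {set T} -> {set T} -> bool) t :
  inv set0 set0 ->
  (forall D B X, inv D B -> #|D| < t -> legal m (~: (D :|: B)) X ->
     exists2 Z, legal b (~: (D :|: B) :\: X) Z & inv (D :|: X) (B :|: Z)) ->
  exists2 ss : sstrategy G, slegal b ss & forall sd, dlegal m sd -> forall n,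
    let h := play sd ss n in
    #|f @^-1: dclaimed h| < t -> inv (f @^-1: dclaimed h) (f @^-1: sclaimed h).
Proof.
move=> inv0 step.
pose dd (h : history G) := f @^-1: dclaimed h.
pose bb (h : history G) := f @^-1: sclaimed h.
pose ok h (X : {set G}) Z :=
  legal b (~: (dd h :|: bb h) :\: f @^-1: X) Z &&
  inv (dd h :|: f @^-1: X) (bb h :|: Z).
pose ss h X : {set G} := f @: odflt set0 [pick Z | ok h X Z].
exists ss.
  move=> h X; apply: imset_legal; rewrite preimsetD preimsetU_claimed.
  by case: pickP => [Z /andP[]//|_]; rewrite /legal sub0set cards0.
move=> sd lsd; elim=> [|n IHn] /=.
  by rewrite /dclaimed /sclaimed !big_nil preimset0.
move: IHn => /=; set h := play sd ss n => IHn.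
rewrite dclaimed_rcons sclaimed_rcons /= !preimsetU => small.
have ltt : #|f @^-1: dclaimed h| < t.
  by apply: leq_ltn_trans small; rewrite subset_leq_card ?subsetUl.
have lX : legal m (~: (dd h :|: bb h)) (f @^-1: sd h).
  by rewrite -preimsetU_claimed; apply/preimset_legal/lsd.
have [Z0 lZ0 iZ0] := step _ _ _ (IHn ltt) ltt lX.
rewrite /ss; case: pickP => [Z /andP[_]|/(_ Z0)] /=.
  by rewrite preimset_imset.
by rewrite /ok lZ0 iZ0.
Qed.

End Transfer.

(** * Monotone families as dominating sets *)

Section DominationGraph.
Variables (T : finType) (win : pred {set T}) (K : nat).

Definition dg_vertex : finType := (T + {set T} * 'I_K)%type.

(* For each non-winning [U] there are [K] twin vertices whose neighbours are the
   cells outside [U]: they are all dominated exactly by the sets of cells not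
   contained in [U], and are too many to be claimed in a set of size < [K]. *)
Definition dg_adj : rel dg_vertex := fun u v =>
  match u, v with
  | inl x, inl y => x != y
  | inl x, inr p | inr p, inl x => win p.1 || (x \notin p.1)
  | inr _, inr _ => false
  end.

Lemma dg_sym : symmetric dg_adj.
Proof. by move=> [x|p] [y|q] //=; rewrite eq_sym. Qed.

Lemma dg_irrefl : irreflexive dg_adj.
Proof. by move=> [x|p] //=; rewrite eqxx. Qed.

Definition dg := SGraph dg_sym dg_irrefl.
Definition cellv (x : T) : dg := inl x.

Lemma cellv_inj : injective cellv.
Proof. by move=> x y []. Qed.

(** [Y] is too small to contain all twins of its own set [U] of cells. Were [U] not winning, a twin
    outside [Y] would have only cells outside [U] as neighbours, none of them in [Y]. *)
Lemma dominating_win (Y : {set dg}) :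
  #|Y| < K -> dominating Y -> win (cellv @^-1: Y).
Proof.
move=> ltYK /forallP dY; apply: contraT => nwin; set U := _ @^-1: Y in nwin.
have [k kY] : exists k, (inr (U, k) : dg) \notin Y.
  apply/existsP; apply: contraTT ltYK => /existsPn allY.
  rewrite -leqNgt -[leqLHS]card_ord -(@card_imset _ _ (fun k => inr (U, k) : dg)).
    by apply/subset_leq_card/subsetP => _ /imsetP[k _ ->]; rewrite -[_ \in _]negbK.
  by move=> k k' [].
move: (dY (inr (U, k))); rewrite (negPf kY) => /existsP[[x|p]] /andP[xY] //=.
by rewrite (negPf nwin) /= inE /cellv xY.
Qed.

Hypothesis win_mono : forall A B : {set T}, A \subset B -> win A -> win B.
Hypothesis win0 : ~~ win set0.

Lemma win_dominating (W : {set T}) : win W -> dominating (cellv @: W).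
Proof.
move=> winW; apply/forallP => -[x|[U k]].
  have [w wW] : exists w, w \in W.
    by apply/set0Pn; apply: contraNneq win0 => <-.
  have [xW|xW] := boolP (x \in W); first by rewrite imset_f.
  apply/orP; right; apply/existsP; exists (cellv w); rewrite imset_f //=.
  by apply: contraNneq xW => <-.
apply/orP; right; apply/existsP.
have [winU|nwinU] := boolP (win U).
  have [w wW] : exists w, w \in W.
    by apply/set0Pn; apply: contraNneq win0 => <-.
  by exists (cellv w); rewrite imset_f //= winU.
have /subsetPn[w wW wU] : ~~ (W \subset U).
  by apply: contraNN nwinU => sWU; apply: win_mono winW.
by exists (cellv w); rewrite imset_f //= wU orbT.
Qed.

End DominationGraph.

(** * The flower and its cores *)

Section Flower.
Variables (m b n N : nat).

(** [None] is the hub. Position 0 of each petal is the hub as well, so [Some (l, 0)] lies on no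
    petal. *)
Definition site : finType := option ('I_b.+1 * 'I_n).
(** The last summand is a reserve outside all blocks and links, so that Dominator never lacks cells
    to pad a core. *)
Definition cell : finType :=
  ('I_m * site + 'I_b.+1 * 'I_n * 'I_b + 'I_N)%type.
Implicit Types (D B W X Z : {set cell}) (o : site) (l : 'I_b.+1) (k : 'I_n).

(* [petal l 0], [petal l 1], ..., [petal l n] is a cycle through the hub [None]. *)
Definition petal l (i : nat) : site :=
  if i == 0 then None else omap (pair l) (insub i).

Definition block o : {set cell} :=
  [set x | if x is inl (inl p) then p.2 == o else false].

Definition link l k : {set cell} :=
  [set x | if x is inl (inr q) then q.1 == (l, k) else false].

Definition core W :=
  [exists l, exists k : 'I_n, exists c in link l k,
    block (petal l k) :|: block (petal l k.+1) :|: [set c] \subset W].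

Lemma petal_out l i : n <= i -> petal l i = None.
Proof.
by rewrite /petal; case: eqP => // _ leni; rewrite insubF // ltnNge leni.
Qed.

Lemma petal_in l (i : nat) (lt_in : i < n) :
  0 < i -> petal l i = Some (l, Ordinal lt_in).
Proof. by rewrite /petal; case: i lt_in => // i lt_in _; rewrite insubT. Qed.

Lemma petal_inj l l' i j :
  0 < i < n -> petal l i = petal l' j -> l = l' /\ i = j.
Proof.
case/andP=> i0 lt_in; rewrite (petal_in l lt_in i0).
have [->|j0] := posnP j; first by [].
have [/petal_out -> //|lt_jn] := leqP n j.
by rewrite (petal_in l' lt_jn j0) => -[-> ->].
Qed.

Lemma card_block o : #|block o| = m.
Proof.
rewrite -[RHS]card_ord -(@card_imset _ _ (fun c => inl (inl (c, o)) : cell)).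
  apply: eq_card => x; rewrite inE; apply/idP/imsetP => [|[c _ ->]]; last by rewrite /= eqxx.
  by case: x => [[[c o']|//]|//] /= /eqP->; exists c.
by move=> c c' [].
Qed.

Lemma card_link l k : #|link l k| = b.
Proof.
rewrite -[RHS]card_ord -(@card_imset _ _ (fun c => inl (inr (l, k, c)) : cell)).
  apply: eq_card => x; rewrite inE; apply/idP/imsetP => [|[c _ ->]]; last by rewrite /= eqxx.
  by case: x => [[//|[lk c]]|//] /= /eqP->; exists c.
by move=> c c' [].
Qed.

Lemma block_disj o o' : o != o' -> [disjoint block o & block o'].
Proof.
move=> neq; apply/pred0P => x /=; rewrite !inE.
case: x => [[[c o1]|//]|//] /=; apply/negP => /andP[/eqP-> /eqP eq_oo'].
by rewrite eq_oo' eqxx in neq.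
Qed.

Lemma block_link_disj o l k : [disjoint block o & link l k].
Proof. by apply/pred0P => x /=; rewrite !inE; case: x => [[?|?]|?]; rewrite ?andbF. Qed.

Lemma link_disj l k k' : k != k' -> [disjoint link l k & link l k'].
Proof.
move=> neq; apply/pred0P => x /=; rewrite !inE.
case: x => [[//|[lk c]]|//] /=; apply/negP => /andP[/eqP-> /eqP[eq_kk']].
by rewrite eq_kk' eqxx in neq.
Qed.

Lemma coreI l k c W :
  c \in link l k -> block (petal l k) \subset W ->
  block (petal l k.+1) \subset W -> c \in W -> core W.
Proof.
move=> cl s1 s2 cW; apply/existsP; exists l; apply/existsP; exists k.
by apply/existsP; exists c; rewrite cl !subUset s1 s2 sub1set cW.
Qed.

Lemma core_sub W W' : W \subset W' -> core W -> core W'.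
Proof.
move=> sWW' /existsP[l /existsP[k /existsP[c /andP[cl s]]]].
apply/existsP; exists l; apply/existsP; exists k; apply/existsP; exists c.
by rewrite cl (subset_trans s).
Qed.

(* A core has at most [2 * m + 1] cells: fewer only if both ends are the hub. *)
Lemma core_small W : core W ->
  exists A : {set cell}, [/\ core A, A \subset W & #|A| <= 2 * m + 1].
Proof.
case/existsP=> l /existsP[k /existsP[c /andP[cl s]]].
exists (block (petal l k) :|: block (petal l k.+1) :|: [set c]); split=> //.
  apply: coreI cl _ _ _; rewrite ?inE ?eqxx ?orbT // -?setUA ?subsetUl //.
  by rewrite setUCA subsetUl.
rewrite (leq_trans (leq_card_setU _ _)) // cards1 leq_add2r.
by rewrite (leq_trans (leq_card_setU _ _)) // !card_block mul2n addnn.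
Qed.


(** * Dominator's strategy *)

Section Dominator.
Variable s : nat.
Hypotheses (m_gt0 : 0 < m) (b_gt0 : 0 < b).

Definition big_core W := core W && (s <= #|W|).
Local Notation wins := (wins_in m b big_core).

(** Dominator adds one free cell per round. A round uses up at most [m + b] cells, so the last
    hypothesis keeps a free one available. *)
Lemma fill_core (k : nat) D B :
  core D -> s <= #|D| + k -> #|D :|: B| + (m + b) * k <= #|{: cell}| ->
  wins k D B.
Proof.
elim: k D B => [|k IHk] D B coreD; first by rewrite addn0 /= /big_core coreD.
rewrite mulnS => les room.
have /subsetPn[x _ xDB] : ~~ ([set: cell] \subset D :|: B).
  by apply/negP => /subset_leq_card; rewrite cardsT; lia.
have lx : legal m (~: (D :|: B)) [set x] by rewrite /legal sub1set inE xDB cards1.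
apply: (wins_inS lx) => Z lZ; apply: IHk; first exact: core_sub (subsetUl _ _) _.
  have xD : x \notin D by apply: contraNN xDB => xD; rewrite inE xD.
  by rewrite setUC cardsU1 xD; lia.
by have := card_round D B lx lZ; lia.
Qed.

Lemma take_link (k : nat) D B l (i : 'I_n) c :
  block (petal l i) \subset D -> block (petal l i.+1) \subset D ->
  c \in link l i -> c \notin B ->
  s <= #|D| + k -> #|D :|: B| + (m + b) * k.+1 <= #|{: cell}| ->
  wins k.+1 D B.
Proof.
move=> s1 s2 cl cB les; rewrite mulnS => room.
have lc : legal m (~: (D :|: B)) ([set c] :\: D).
  rewrite /legal (leq_trans (subset_leq_card (subsetDl _ _))) ?cards1 // andbT.
  by apply/subsetP => x; rewrite !inE => /andP[/negPf-> /eqP->].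
have sD' : D \subset D :|: [set c] :\: D by exact: subsetUl.
apply: (wins_inS lc) => Z lZ; apply: fill_core.
- apply: coreI cl _ _ _; [exact: subset_trans s1 _|exact: subset_trans s2 _|].
  by rewrite !inE eqxx andbT orbN.
- by have := subset_leq_card sD'; lia.
by have := card_round D B lc lZ; lia.
Qed.

(** The rounds are [r + 1] blocks, one link cell and [s] fillers. Staller either leaves open a cell
    of the link just threatened or spends his whole move on it, and then the petal ahead is still
    untouched. *)
Lemma walk_petal l r i D B : i + r.+2 = n ->
  block None \subset D -> block (petal l i) \subset D ->
  (forall j, i < j < n -> [disjoint block (petal l j) & B]) ->
  (forall k : 'I_n, i <= k -> [disjoint link l k & B]) ->
  #|D :|: B| + (m + b) * (r + s + 2) <= #|{: cell}| ->
  wins (r + s + 2) D B.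
Proof.
elim/ltn_ind: r i D B => r IHr i D B def_n sH si dblock dlink room.
have lt_in : i < n by lia.
pose e := Ordinal lt_in.
pose X := block (petal l i.+1) :\: D.
have lX : legal m (~: (D :|: B)) X.
  rewrite /legal (leq_trans (subset_leq_card (subsetDl _ _))) ?card_block //.
  rewrite andbT setCU /X setDE [block _ :&: _]setIC setIS //.
  by rewrite -disjoints_subset dblock //; lia.
rewrite addn2; apply: (wins_inS lX) => Z lZ.
have room' := card_round D B lX lZ.
have s1 : block (petal l i.+1) \subset D :|: X.
  by apply/subsetP => x xb; rewrite in_setU in_setD xb andbT orbN.
have [cardE|ltE] := leqP (#|link l e|) #|link l e :&: Z|; last first.
  have /subsetPn[c cl cZ] : ~~ (link l e \subset Z).
    by apply: contraTN ltE => /setIidPl->; rewrite ltnn.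
  apply: (@take_link _ _ _ l e c) => //; try lia.
    exact: subset_trans si (subsetUl _ _).
  by rewrite inE negb_or cZ (disjointFr (dlink e _) cl).
have defZ : link l e :&: Z = Z.
  apply/eqP; rewrite eqEcard subsetIr (leq_trans _ cardE) // card_link.
  by case/andP: lZ.
have dlink' (k : 'I_n) : i < k -> [disjoint link l k & B :|: Z].
  move=> ik; rewrite -setI_eq0 setIUr setU_eq0 !setI_eq0 dlink ?andTb; last by lia.
  by rewrite -defZ (disjointWr (subsetIl _ _)) // link_disj // -val_eqE /=; lia.
case: r IHr def_n room => [_|r IHr] def_n room.
  (* Node [i + 2] is the hub, owned already. Staller's whole move went into link [i], so link
     [i + 1] is open. *)
  have lt_i1n : i.+1 < n by lia.
  pose e1 := Ordinal lt_i1n.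
  have [c cl] : exists c, c \in link l e1.
    by apply/set0Pn; rewrite -card_gt0 card_link.
  apply: (@take_link _ _ _ l e1 c) => //; try lia.
    by rewrite petal_out ?(subset_trans sH) ?subsetUl //=; lia.
  by rewrite (disjointFr (dlink' e1 _) cl) //=.
have -> : (r.+1 + s).+1 = r + s + 2 by lia.
apply: (IHr r _ i.+1) => //; try lia.
  exact: subset_trans sH (subsetUl _ _).
move=> j ij; rewrite -setI_eq0 setIUr setU_eq0 !setI_eq0 dblock ?andTb; last by lia.
by rewrite -defZ (disjointWr (subsetIl _ _)) // block_link_disj.
Qed.

Definition lane (x : cell) : option 'I_b.+1 :=
  match x with
  | inl (inl (_, Some (l, _))) | inl (inr (l, _, _)) => Some l
  | _ => None
  end.

Lemma lane_block (x : cell) l i : 0 < i < n -> x \in block (petal l i) -> lane x = Some l.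
Proof.
case/andP=> i0 lt_in; rewrite (petal_in l lt_in i0) inE.
by case: x => [[[c o]|?]|?] //= /eqP->.
Qed.

Lemma lane_link (x : cell) l k : x \in link l k -> lane x = Some l.
Proof. by rewrite inE; case: x => [[?|[[l' k'] c]]|?] //= /eqP[-> _]. Qed.

(** Pigeonhole: [b] cells meet at most [b] of the [b + 1] petals. *)
Lemma untouched_petal Z : #|Z| <= b -> exists l, forall x, x \in Z -> lane x != Some l.
Proof.
move=> cZ.
have /subsetPn[l _] : ~~ ([set: 'I_b.+1] \subset [set l | Some l \in lane @: Z]).
  apply/negP => /subset_leq_card; rewrite cardsT card_ord.
  apply/negP; rewrite -ltnNge ltnS (leq_trans _ cZ) //.
  rewrite (leq_trans _ (leq_imset_card lane _)) //.
  rewrite -(@card_imset _ _ (@Some 'I_b.+1)); last by move=> ? ? [].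
  by apply/subset_leq_card/subsetP => _ /imsetP[l + ->]; rewrite inE.
rewrite inE => /imsetP nl; exists l => x xZ; apply/eqP => lx.
by apply: nl; exists x.
Qed.

Lemma dominator_wins : 1 < n -> (m + b) * (n + s).+1 <= #|{: cell}| ->
  wins (n + s).+1 set0 set0.
Proof.
move=> n_gt1 room.
have lX : legal m (~: (set0 :|: set0)) (block None).
  by rewrite /legal card_block leqnn setU0 setC0 subsetT.
apply: (wins_inS lX) => Z lZ.
have [l lP] : exists l, forall x, x \in Z -> lane x != Some l.
  by apply: untouched_petal; case/andP: lZ.
have -> : n + s = (n - 2) + s + 2 by lia.
apply: (@walk_petal l _ 0); rewrite ?set0U //; first by lia.
- move=> j jn; apply/pred0P => x /=; apply/negP => /andP[xb /lP].
  by rewrite (lane_block jn xb) eqxx.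
- move=> k _; apply/pred0P => x /=; apply/negP => /andP[xb /lP].
  by rewrite (lane_link xb) eqxx.
have := card_round set0 set0 lX lZ; rewrite !set0U cards0 => le.
have -> : n - 2 + s + 2 = n + s by lia.
by move: room; rewrite mulnS; lia.
Qed.

End Dominator.

(** * Staller's delaying strategy *)

Section Staller.
Variable t : nat.
Hypotheses (m_gt0 : 0 < m) (le_mb : m <= b).

Definition killed B o := ~~ [disjoint block o & B].

Definition cut B l (k : 'I_n) :=
  [|| killed B (petal l k), killed B (petal l k.+1) | link l k \subset B].

(* The hub counts as owned from the start. *)
Definition owned D l (i : nat) :=
  [|| i == 0, i == n | block (petal l i) \subset D].

Definition uncut_between B l (i j : nat) :=
  [forall k : 'I_n, (i <= k < j) ==> ~~ cut B l k].

(** The second and third clauses make Dominator's partial work worthless: what she touched without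
    completing it is spoiled. The last clause is a potential: each of her cells may halve the
    distance, which still exceeds 1 while [#|D| < t]. *)
Definition staller_inv D B :=
  [&& [disjoint D & B],
      [forall o, [|| killed B o, block o \subset D | [disjoint block o & D]]],
      [forall l, forall k,
        [|| [disjoint link l k & D], killed B (petal l k)
          | killed B (petal l k.+1)]] &
      [forall l, forall i : 'I_n.+1, forall j : 'I_n.+1,
        [&& i < j, owned D l i, owned D l j & uncut_between B l i j] ==>
          (2 ^ (t - #|D|) <= j - i)]].

Lemma staller_invP D B :
  reflect [/\ [disjoint D & B],
      forall o, [|| killed B o, block o \subset D | [disjoint block o & D]],
      forall l k, [|| [disjoint link l k & D], killed B (petal l k)
          | killed B (petal l k.+1)] &
      forall l (i j : nat), i < j <= n -> owned D l i -> owned D l j ->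
        uncut_between B l i j -> 2 ^ (t - #|D|) <= j - i] (staller_inv D B).
Proof.
apply: (iffP and4P) => -[dDB kD lD gap]; split => //.
- exact/forallP.
- by move=> l k; apply: (forallP (forallP lD l)).
- move=> l i j /andP[ij jn] oi oj u.
  have := forallP (forallP (forallP gap l) (inord i)) (inord j).
  by rewrite !inordK ?ltnS ?(leq_trans (ltnW ij)) // ij oi oj u.
- exact/forallP.
- by apply/forallP => l; apply/forallP => k.
apply/forallP => l; apply/forallP => i; apply/forallP => j.
apply/implyP => /and4P[ij oi oj u]; apply: (gap l) => //.
by rewrite ij -ltnS ltn_ord.
Qed.

Lemma killed_sub B B' o : B \subset B' -> killed B o -> killed B' o.
Proof. by move=> sB; apply: contraNN; apply: disjointWr. Qed.

Lemma cut_sub B B' l k : B \subset B' -> cut B l k -> cut B' l k.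
Proof.
move=> sB /or3P[/(killed_sub sB)|/(killed_sub sB)|/subset_trans/(_ sB)] cB;
by rewrite /cut cB ?orbT.
Qed.

Lemma uncut_sub B B' l i j :
  B \subset B' -> uncut_between B' l i j -> uncut_between B l i j.
Proof.
move=> sB /forallP u; apply/forallP => k; apply/implyP => ikj.
by apply: contraNN (implyP (u k) ikj); apply: cut_sub.
Qed.

Lemma killedN D B o : [disjoint D & B] -> block o \subset D -> ~~ killed B o.
Proof. by move=> dDB sD; rewrite negbK; apply: disjointWl dDB. Qed.

Lemma legal_disjoint q D B X Z : [disjoint D & B] ->
  legal m (~: (D :|: B)) X -> legal q (~: (D :|: B) :\: X) Z ->
  [disjoint D :|: X & B :|: Z].
Proof.
move=> dDB /andP[sX _] /andP[sZ _]; apply/pred0P => x /=; apply/negP.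
rewrite !in_setU => /andP[xDX xBZ].
case/orP: xBZ => [xB|/(subsetP sZ)]; last first.
  by rewrite in_setD in_setC in_setU; case/orP: xDX => ->; rewrite ?andbF ?orTb.
case/orP: xDX => [/(disjointFr dDB)|/(subsetP sX)]; first by rewrite xB.
by rewrite in_setC in_setU xB orbT.
Qed.

Lemma owned_new D X l i :
  [disjoint block (petal l i) & X] -> owned (D :|: X) l i -> owned D l i.
Proof.
move=> dX /or3P[e|e|/subsetP sD]; rewrite /owned ?e ?orbT //.
apply/or3P/Or33/subsetP => x xb; have := sD x xb.
by rewrite in_setU (disjointFr dX xb) orbF.
Qed.

Lemma legal_free D B X x : legal m (~: (D :|: B)) X -> x \in X ->
  (x \notin D) && (x \notin B).
Proof. by case/andP=> /subsetP sX _ /sX; rewrite in_setC in_setU negb_or. Qed.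

(** The ends of such a core are not killed, so its link cell is new by the third clause. At most
    [m - 1] other cells are new, too few for a block; both blocks were thus owned before, uncut and
    at distance 1. *)
Lemma staller_inv_no_core D B X :
  staller_inv D B -> #|D| < t -> legal m (~: (D :|: B)) X -> ~~ core (D :|: X).
Proof.
case/staller_invP=> dDB kD lD gap ltt lX.
apply/negP => /existsP[l /existsP[k /existsP[c /andP[cl]]]].
rewrite !subUset sub1set => /andP[/andP[s1 s2] cDX].
have dDXB : [disjoint D :|: X & B].
  have l0 : legal m (~: (D :|: B) :\: X) set0 by rewrite /legal sub0set cards0.
  by rewrite -[B]setU0; apply: legal_disjoint l0.
have [k1 k2] := (killedN dDXB s1, killedN dDXB s2).
have cX : c \in X.
  have := lD l k; rewrite (negPf k1) (negPf k2) !orbF => d.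
  by move: cDX; rewrite in_setU (disjointFr d cl).
have sub_owned o : block o \subset D :|: X -> ~~ killed B o -> block o \subset D.
  move=> so /negPf ko; have := kD o; rewrite ko /= => /orP[//|d].
  have soX : block o \subset X :\ c.
    apply/subsetP => x xo; rewrite in_setD1.
    have := subsetP so x xo; rewrite in_setU (disjointFr d xo) /= => ->.
    rewrite andbT; apply: contraTneq xo => ->.
    by rewrite (disjointFl (block_link_disj _ _ _) cl).
  have := subset_leq_card soX; rewrite card_block.
  by case/andP: lX => _; rewrite (cardsD1 c X) cX; clear; lia.
have := gap l k k.+1; rewrite ltnSn ltn_ord => /(_ isT).
rewrite /owned !sub_owned // !orbT => /(_ isT isT).
have u : uncut_between B l k k.+1.
  apply/forallP => k'; apply/implyP => /andP[kk' k'k].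
  have -> : k' = k by apply/val_inj; move: kk' k'k => /=; clear; lia.
  rewrite /cut (negPf k1) (negPf k2) /=; apply/subsetPn; exists c => //.
  by rewrite (disjointFr dDXB cDX).
by move/(_ u); rewrite subSnn leqNgt -[1](expn0 2) ltn_exp2l // subn_gt0 ltt.
Qed.

(** The move is exactly one block. Since [#|D|] grows, the required distance at least halves, to
    some [q]; a new node between nodes at distance [2q] or more is closer than [q] to at most one of
    them, and one cut suffices. *)
Lemma reply_block D B X o : staller_inv D B -> #|D| < t ->
  legal m (~: (D :|: B)) X -> block o \subset X ->
  exists2 Z, legal b (~: (D :|: B) :\: X) Z &
    staller_inv (D :|: X) (B :|: Z).
Proof.
case/staller_invP=> dDB kD lD gap ltt lX soX.
have defX : X = block o.
  by apply/eqP; rewrite eq_sym eqEcard soX card_block; case/andP: lX.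
have ltD' : #|D| < #|D :|: X|.
  rewrite cardsU (_ : D :&: X = set0) ?cards0 ?defX ?card_block ?subn0.
    by rewrite -[ltnLHS]addn0 ltn_add2l.
  apply/eqP; rewrite setI_eq0 disjoint_sym; apply/pred0P => x /=; apply/negP.
  by move=> /andP[xX xD]; have := legal_free lX (subsetP soX _ xX); rewrite xD.
pose q := 2 ^ (t - #|D :|: X|).
have le_2q : q + q <= 2 ^ (t - #|D|).
  rewrite addnn -mul2n -expnS leq_exp2l //; move: ltt ltD'; clear; lia.
have ownedE l i : petal l i != o -> owned (D :|: X) l i -> owned D l i.
  by move=> neq; apply: owned_new; rewrite defX block_disj.
have finish Z : legal b (~: (D :|: B) :\: X) Z ->
    (forall l (i j : nat), i < j <= n -> owned (D :|: X) l i ->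
       owned (D :|: X) l j -> uncut_between (B :|: Z) l i j -> q <= j - i) ->
    staller_inv (D :|: X) (B :|: Z).
  move=> lZ gap'; apply/staller_invP.
  have sB : B \subset B :|: Z by apply: subsetUl.
  split=> // [|o'|l k]; first exact: legal_disjoint lZ.
    have [->|neq] := eqVneq o' o.
      by rewrite defX subsetUr orbT.
    have /or3P[/(killed_sub sB)->//|so'|d] := kD o'.
      by rewrite (subset_trans so' (subsetUl _ _)) orbT.
    rewrite [X in [|| _, _ | X]](_ : _ = true) ?orbT //.
    by rewrite -setI_eq0 setIUr setU_eq0 !setI_eq0 d defX block_disj.
  have /or3P[d|/(killed_sub sB)->|/(killed_sub sB)->] := lD l k; rewrite ?orbT //.
  rewrite -setI_eq0 setIUr setU_eq0 !setI_eq0 d defX.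
  by rewrite disjoint_sym block_link_disj.
have [|noti] := boolP [exists l, exists i : 'I_n, (0 < i) && (petal l i == o)];
  last first.
  (* A block at the hub or off the petals adds no owned node, so Staller passes. *)
  exists set0; first by rewrite /legal sub0set cards0.
  apply: finish; first by rewrite /legal sub0set cards0.
  have own l (i : nat) : i <= n -> owned (D :|: X) l i -> owned D l i.
    move=> le_in; have [->//|i0] := posnP i.
    have [->|nn] := eqVneq i n; first by rewrite /owned eqxx orbT.
    have lt_in : i < n by rewrite ltn_neqAle nn.
    apply: ownedE; apply: contraNneq noti => def_o.
    apply/existsP; exists l; apply/existsP; exists (Ordinal lt_in).
    by rewrite i0 def_o /=.
  move=> l i j ij oi oj; rewrite setU0 => u.
  apply: leq_trans (leq_trans le_2q _); first exact: leq_addr.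
  by apply: (gap l) => //; apply: own => //; move: ij; clear; lia.
case/existsP=> l0 /existsP[i0 /andP[i0_gt0 /eqP def_o]].
have i0P : 0 < i0 < n by rewrite i0_gt0 /=.
have own l (i : nat) :
    (l, i) != (l0, val i0) -> owned (D :|: X) l i -> owned D l i.
  move=> neq; apply: ownedE; rewrite -def_o eq_sym; apply: contraNneq neq => eq_p.
  by case: (petal_inj i0P eq_p) => -> <-.
have own_i0 l i :
    owned (D :|: X) l i -> (l == l0) && (i == i0) || owned D l i.
  by move=> oi; rewrite -xpair_eqE; case: eqVneq => // /own->.
(* If the link is not yet cut, the third clause keeps Dominator out of it, so its free cells, at
   most [b], form a legal reply. *)
have cutting (k : 'I_n) :
    exists2 Z, legal b (~: (D :|: B) :\: X) Z & cut (B :|: Z) l0 k.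
  have [ck|nck] := boolP (cut B l0 k).
    by exists set0; rewrite ?setU0 // /legal sub0set cards0.
  exists (link l0 k :\: B); last first.
    apply/or3P/Or33/subsetP => x xl.
    by rewrite in_setU in_setD xl andbT orbN.
  rewrite /legal (leq_trans (subset_leq_card (subsetDl _ _))) ?card_link // andbT.
  move: nck; rewrite /cut !negb_or => /and3P[/negPf k1 /negPf k2 _].
  have := lD l0 k; rewrite k1 k2 !orbF => d.
  apply/subsetP => x; rewrite in_setD => /andP[xB xl].
  rewrite in_setD in_setC in_setU (negPf xB) (disjointFr d xl) defX.
  by rewrite (disjointFl (block_link_disj _ _ _) xl).
have uncutZ Z l i j : uncut_between (B :|: Z) l i j -> uncut_between B l i j.
  by apply: uncut_sub; apply: subsetUl.
pose badL := [exists a : 'I_n, [&& a < i0, owned D l0 a,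
  uncut_between B l0 a i0 & i0 - a < q]].
(* If both sides of the new block were short, the owned blocks on either side of
   it would have been too close before. *)
have [/existsP[a /and4P[ai oa ua qa]]|okL] := boolP badL.
  have lt_k : i0.-1 < n by move: (ltn_ord i0); clear; lia.
  have [Z lZ cZ] := cutting (Ordinal lt_k).
  exists Z => //; apply: finish => // l i j ij oi oj u.
  have [/andP[/eqP ll /eqP ii]|oi'] := orP (own_i0 l i oi).
    subst l i.
    have oj' : owned D l0 j.
      by apply: own oj; rewrite xpair_eqE eqxx /=; move: ij; clear; lia.
    have uaj : uncut_between B l0 a j.
      apply/forallP => k; apply/implyP => akj.
      have [ki|ik] := ltnP k i0.
        by apply: (implyP (forallP ua k)); move: akj ki; clear; lia.
      by apply: (implyP (forallP (uncutZ _ _ _ _ u) k)); move: akj ik; clear; lia.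
    have ajn : a < j <= n by move: ai ij; clear; lia.
    by have := gap l0 a j ajn oa oj' uaj; move: le_2q qa ai ij; clear; lia.
  have [/andP[/eqP ll /eqP jj]|oj'] := orP (own_i0 l j oj).
    have := forallP u (Ordinal lt_k).
    by rewrite ll cZ implybF /=; move: jj ij i0_gt0; clear; lia.
  by have := gap l i j ij oi' oj' (uncutZ _ _ _ _ u); move: le_2q; clear; lia.
have [Z lZ cZ] := cutting i0.
exists Z => //; apply: finish => // l i j ij oi oj u.
have [/andP[/eqP ll /eqP ii]|oi'] := orP (own_i0 l i oi).
  by have := forallP u i0; rewrite ll cZ implybF; move: ii ij; clear; lia.
have [/andP[/eqP ll /eqP jj]|oj'] := orP (own_i0 l j oj).
  subst l j; move: okL => /existsPn ok.
  have lt_in : i < n by move: ij; clear; lia.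
  have := ok (Ordinal lt_in); rewrite /= oi' (uncutZ _ _ _ _ u) /=.
  by case/andP: ij => -> _ /=; rewrite -leqNgt.
by have := gap l i j ij oi' oj' (uncutZ _ _ _ _ u); move: le_2q; clear; lia.
Qed.

(** One reply cell per claimed cell makes at most [m <= b]. Every block that the move touched ends
    up killed, so no new node becomes owned. *)
Lemma reply_partial D B X : staller_inv D B -> #|D| < t ->
  legal m (~: (D :|: B)) X -> (forall o, ~~ (block o \subset X)) ->
  exists2 Z, legal b (~: (D :|: B) :\: X) Z &
    staller_inv (D :|: X) (B :|: Z).
Proof.
case/staller_invP=> dDB kD lD gap ltt lX noblk.
(* A block cell is answered in its own block, a link cell in an end that Dominator does not own,
   unless an end is killed already. *)
pose target (x : cell) : option site :=
  match x with
  | inl (inl (_, o)) => Some o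
  | inl (inr (l, k, _)) =>
      if killed B (petal l k) || killed B (petal l k.+1) then None
      else if block (petal l k) \subset D then Some (petal l k.+1)
      else Some (petal l k)
  | inr _ => None
  end.
have target_block x o : x \in block o -> target x = Some o.
  by rewrite inE; case: x => [[[c o']|?]|?] //= /eqP->.
have targetP x o : x \in X -> target x = Some o -> ~~ killed B o ->
    [disjoint block o & D].
  move=> xX tx /negPf ko; have := kD o; rewrite ko /= => /orP[so|//].
  have /andP[xD xB] := legal_free lX xX.
  case: x tx xX xD xB => [[[c o']|[[l k] c]]|//] /=.
    case=> def_o _ /negP[]; apply: (subsetP so).
    by rewrite inE def_o /=.
  case: ifP => // /negbT; rewrite negb_or => /andP[k1 k2].
  case: ifP => [s1 [def_o] xX xD xB|/negP ns1 [def_o]]; last by rewrite def_o in ns1.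
  have cl : inl (inr (l, k, c)) \in link l k by rewrite inE /=.
  (* Both ends are owned and the claimed cell was free, so they are uncut at distance 1, which the
     last clause excludes. *)
  have := gap l k k.+1; rewrite ltnSn ltn_ord /owned s1 def_o so !orbT.
  move=> /(_ isT isT isT).
  have u : uncut_between B l k k.+1.
    apply/forallP => k'; apply/implyP => /andP[kk' k'k].
    have -> : k' = k by apply/val_inj; move: kk' k'k => /=; clear; lia.
    rewrite /cut (negPf k1) (negPf k2) /=; apply/subsetPn.
    by exists (inl (inr (l, k, c))).
  by move/(_ u); rewrite subSnn leqNgt -[1](expn0 2) ltn_exp2l // subn_gt0 ltt.
pose answer (x : cell) : option cell :=
  obind (fun o => if killed B o then None else [pick y in block o :\: X])
        (target x).
pose Z := [set y | Some y \in answer @: X].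
have ZP y : y \in Z -> exists x o, [/\ x \in X, target x = Some o,
    ~~ killed B o & y \in block o :\: X].
  rewrite inE => /imsetP[x xX]; rewrite /answer.
  case tx: (target x) => [o|] //=; case: ifP => // /negbT ko.
  by case: pickP => // y' y'P [->]; exists x, o.
have lZ : legal b (~: (D :|: B) :\: X) Z.
  rewrite /legal; apply/andP; split; last first.
    rewrite (leq_trans _ le_mb) //; case/andP: lX => _; apply: leq_trans.
    rewrite (leq_trans _ (leq_imset_card answer _)) //.
    rewrite -(@card_imset _ _ (@Some cell)); last by move=> ? ? [].
    by apply/subset_leq_card/subsetP => _ /imsetP[y + ->]; rewrite inE.
  apply/subsetP => y /ZP[x [o [xX tx ko]]]; rewrite in_setD => /andP[yX yo].
  rewrite in_setD yX in_setC in_setU (disjointFr (targetP _ _ xX tx ko) yo) /=.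
  by move: ko; rewrite negbK => d; rewrite (disjointFr d yo).
have sB : B \subset B :|: Z by apply: subsetUl.
have dD'B' := legal_disjoint dDB lX lZ.
have target_killed x o : x \in X -> target x = Some o -> killed (B :|: Z) o.
  move=> xX tx; have [/(killed_sub sB)//|ko] := boolP (killed B o).
  (* [X] contains no whole block, so the pick in [answer] succeeds. *)
  have [y yo yZ] : exists2 y, y \in block o & y \in Z.
    have : answer x \in answer @: X by apply: imset_f.
    rewrite {1}/answer tx /= (negPf ko); case: pickP => [y yP|none] aX.
      by case/setDP: yP => yo _; exists y => //; rewrite inE.
    case/subsetPn: (noblk o) => y yo yX.
    by have := none y; rewrite in_setD yX yo.
  by apply/negP => d; have := disjointFr d yo; rewrite in_setU yZ orbT.
have touched o : ~~ killed (B :|: Z) o -> [disjoint block o & X].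
  move=> nk; apply/pred0P => x /=; apply/negP => /andP[xo xX].
  by case/negP: nk; apply: target_killed xX (target_block _ _ xo).
have own l i : owned (D :|: X) l i -> owned D l i.
  move=> oi; have /or3P[i0|i0|s] := oi; try by rewrite /owned i0 ?orbT.
  by apply: owned_new oi; apply: touched; apply: killedN dD'B' s.
exists Z => //; apply/staller_invP; split=> // [o|l k|l i j ij oi oj u].
- have [//|nk] /= := boolP (killed (B :|: Z) o).
  have d := touched o nk.
  have /or3P[/(killed_sub sB)|so|d'] := kD o; first by rewrite (negPf nk).
    by rewrite (subset_trans so (subsetUl _ _)).
  by rewrite -[[disjoint _ & _ :|: _]]setI_eq0 setIUr setU_eq0 !setI_eq0 d' d orbT.
- have [dX|] := boolP [disjoint link l k & X].
    have /or3P[d|/(killed_sub sB)->|/(killed_sub sB)->] := lD l k; rewrite ?orbT //.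
    by rewrite -setI_eq0 setIUr setU_eq0 !setI_eq0 d dX.
  case/pred0Pn=> x /= /andP[xl xX].
  move: xl (target_killed x) xX; rewrite inE.
  case: x => [[//|[lk c]]|//] /= /eqP-> tk xX.
  move: (tk); case: ifP => [/orP[]/(killed_sub sB)->|_]; rewrite ?orbT //.
  by case: ifP => _ /(_ _ xX erefl)->; rewrite ?orbT.
apply: leq_trans (gap l i j ij (own _ _ oi) (own _ _ oj) (uncut_sub sB u)).
rewrite leq_exp2l // leq_sub2l // subset_leq_card ?subsetUl //.
Qed.

Lemma staller_reply D B X : staller_inv D B -> #|D| < t ->
  legal m (~: (D :|: B)) X ->
  exists2 Z, legal b (~: (D :|: B) :\: X) Z &
    staller_inv (D :|: X) (B :|: Z).
Proof.
move=> inv ltt lX.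
have [/existsP[o so]|noblk] := boolP [exists o, block o \subset X].
  exact: reply_block inv ltt lX so.
apply: reply_partial => // o; apply: contraNN noblk => so.
by apply/existsP; exists o.
Qed.

(** At first a petal has only its two ends owned, both the hub, at distance [n]. *)
Lemma staller_inv0 : 2 ^ t <= n -> staller_inv set0 set0.
Proof.
move=> le_n; apply/staller_invP.
split=> [|o|l k|l i j ij oi oj _].
- by rewrite -setI_eq0 setI0.
- by rewrite -[[disjoint block _ & _]]setI_eq0 setI0 eqxx !orbT.
- by rewrite -setI_eq0 setI0 eqxx.
have ends i' : owned set0 l i' -> (i' == 0) || (i' == n).
  case/or3P=> [->|->|]; rewrite ?orbT // => /subset_leq_card.
  by rewrite card_block cards0 leqNgt m_gt0.
by rewrite cards0 subn0; move: (ends _ oi) (ends _ oj) le_n ij; clear; lia.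
Qed.

End Staller.

End Flower.

(** * The graph and its two properties *)

Theorem theorem1p5 (m b s t : nat)
    (hm : 1 <= m) (hmb : m <= b) (hs : 2 * m + 1 <= s) (hst : s < t) :
  exists G : sgraph, s_MB_is G m b s /\ staller_can_force G m b s t.
Proof.
have [n def_n] : exists n, n = 2 ^ t by exists (2 ^ t).
(* The reserve alone outlasts the [n + s + 1] rounds of [dominator_wins], at [m + b] cells per
   round. *)
have [N def_N] : exists N, N = (m + b) * (n + s).+1 by eexists.
pose win (W : {set cell m b n N}) := (t <= #|W|) || big_core s W.
have win_mono (A B : {set cell m b n N}) : A \subset B -> win A -> win B.
  move=> sAB /orP[le_t|/andP[cA le_s]]; apply/orP.
    by left; apply: leq_trans le_t (subset_leq_card sAB).
  right; rewrite /big_core (core_sub sAB cA).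
  exact: leq_trans le_s (subset_leq_card sAB).
have win0 : ~~ win set0.
  by rewrite /win /big_core cards0 !leqn0 negb_or negb_and -!lt0n; apply/andP; split; lia.
pose G := dg win t; pose f : cell m b n N -> G := @cellv _ win t.
have f_inj : injective f by apply: cellv_inj.
have card_f (A : {set cell m b n N}) : #|f @: A| = #|A| by rewrite card_imset.
have pre_le (Y : {set G}) : #|f @^-1: Y| <= #|Y|.
  by rewrite -card_f subset_leq_card ?sub_imset_pre.
have dom_big (Y : {set G}) : dominating Y -> #|Y| < t -> big_core s (f @^-1: Y).
  move=> dY ltY; have /orP[|//] := dominating_win ltY dY.
  by rewrite leqNgt (leq_ltn_trans (pre_le Y) ltY).
exists G; split; first split.
- apply: (@wins_in_can_claim G _ f m b f_inj (@big_core m b n N s) s (n + s).+1).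
    move=> D /andP[/core_small[A [cA sAD leA]] leD].
    have [|Y [sAY sYD cY]] := subset_between sAD (k := s).
      by rewrite leD (leq_trans leA).
    exists (f @: Y); split; [exact: imsetS| |by rewrite card_f cY].
    by apply: win_dominating => //; rewrite /win /big_core (core_sub sAY cA) cY leqnn orbT.
  apply: dominator_wins => //; first exact: leq_trans hmb.
    by rewrite def_n -[1](expn0 2) ltn_exp2l //; lia.
  by rewrite card_sum card_ord def_N leq_addl.
(* Staller may simply pass: a dominating set of fewer than [t] vertices contains a big core, hence
   at least [s] cells. *)
- move=> k [sd _ /(_ (fun _ _ => set0))[]].
    by move=> h X; rewrite sub0set cards0.
  move=> r [Y [_ dY leY]]; rewrite leqNgt; apply/negP => ltk.
  have ltY : #|Y| < s by apply: leq_ltn_trans ltk.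
  have /andP[_] := dom_big Y dY (ltn_trans ltY hst).
  by rewrite leqNgt (leq_ltn_trans (pre_le Y) ltY).
have le_n : 2 ^ t <= n by rewrite def_n.
have [ss lss inv] := staller_invariant f_inj (staller_inv0 b N hm le_n)
  (staller_reply hm hmb).
exists ss => // sd lsd r [Y [sY dY cY]].
pose d i := f @^-1: dclaimed (play sd ss i).
have core_r : core (d r).
  have /andP[cY' _] : big_core s (f @^-1: Y) by apply: dom_big; rewrite ?cY.
  by apply: core_sub cY'; apply: preimsetS.
(* After [i.+1] rounds Dominator owns a core for the first time; the invariant then forces at least
   [t] cells after [i] rounds. *)
have [[|i] core_i min_i] := ex_minnP (ex_intro (fun i => core (d i)) r core_r).
  case/existsP: core_i => l /existsP[k /existsP[c /andP[_ /subsetP/(_ c)]]].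
  by rewrite !inE eqxx orbT /dclaimed big_nil inE => /(_ isT).
have lt_ir : i < r by apply: min_i.
have ncore : ~~ core (d i) by apply/negP => /min_i; rewrite ltnn.
have le_t : t <= #|d i|.
  rewrite leqNgt; apply/negP => ltt.
  have lX : legal m (~: (d i :|: f @^-1: sclaimed (play sd ss i)))
      (f @^-1: sd (play sd ss i)).
    by rewrite -preimsetU_claimed; apply/preimset_legal/lsd.
  have := staller_inv_no_core (inv sd lsd i ltt) ltt lX.
  by move: core_i; rewrite /d /= dclaimed_rcons preimsetU => ->.
exists i => //.
have [|T [_ sT cT]] := subset_between (sub0set (d i)) (k := t).
  by rewrite cards0 le_t.
exists (f @: T); split; [by rewrite sub_imset_pre| |by rewrite card_f].
apply/minsetP; split.
  by apply: win_dominating => //; rewrite /win cT leqnn.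
(* A proper dominating subset has fewer than [t] vertices, so its cells contain a core, which
   Dominator does not own after [i] rounds. *)
move=> Y' dY' sY'; apply/eqP; rewrite eqEcard sY' leqNgt; apply/negP => ltY'.
have /andP[coreY' _] : big_core s (f @^-1: Y').
  by apply: dom_big => //; rewrite -cT -card_f.
case/negP: ncore; apply: core_sub coreY'; apply: subset_trans _ sT.
by rewrite -(preimset_imset f_inj T) preimsetS.
Qed.
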